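(* Let $p$ be a prime. If $G$ is an extraspecial group of order $p^{1+2n}$, for $n \geq 1$, then $\rho_0(G) \leq p$.
   Context: An extraspecial group is a finite $p$-group $G$ such that $G' = Z(G) = \Phi(G)$ is cyclic of order $p$, where $G'$ is the commutator subgroup, $Z(G)$ the centre and $\Phi(G)$ the Frattini subgroup. A triple $(S,T,U)$ of subgroups of a group $G$ is a subgroup TPP triple of $G$ if for all $s\in S$, $t\in T$, $u\in U$ one has $stu=1 \iff s=t=u=1$. For a finite group $G$ the subgroup TPP ratio is $\rho_0(G) := \max \frac{|S||T||U|}{|G|}$, where the maximum is over all subgroup TPP triples $(S,T,U)$ of $G$. *)

(* Defs.v *)
From mathcomp Require Import all_boot all_order all_algebra all_fingroup.
From mathcomp Require Import all_solvable.

Set Implicit Arguments.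
Unset Strict Implicit.
Unset Printing Implicit Defensive.

Import Order.TTheory GRing.Theory Num.Theory.

Section SubgroupTPP.

Variable gT : finGroupType.
Implicit Types G S T U : {group gT}.

Definition subgroup_TPP G S T U : bool :=
  [&& S \subset G, T \subset G, U \subset G
    & [forall s in S, forall t in T, forall u in U,
        (s * t * u == 1)%g == [&& s == 1, t == 1 & u == 1]%g]].

(* The trivial triple is admissible and all the ratios are positive, so the
   default value 0 of the iterated maximum is never attained. *)
Definition rho0 G : rat :=
  (\big[Num.max/0]_(X : {group gT} * {group gT} * {group gT}
                     | subgroup_TPP G X.1.1 X.1.2 X.2)
     ((#|X.1.1| * #|X.1.2| * #|X.2|)%N%:R / #|G|%:R))%R.

End SubgroupTPP.

(* Main.v *)
Require Import Defs.
From mathcomp Require Import all_boot all_order all_algebra all_fingroup.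
From mathcomp Require Import all_solvable.
From mathcomp Require Import finfield.

(** Let [Z] be the centre of the extraspecial group [G], of order [p], and let
    [(S, T, U)] be a subgroup TPP triple.  Since [G / Z] is abelian, the
    product map [(s, t, u) |-> s t u] induces a homomorphism
    [S * T * U -> G / Z]; let [K] be its kernel, the triples whose product is
    central.  Then [#|S| #|T| #|U| <= #|G / Z| #|K|], so the bound
    [#|S| #|T| #|U| <= p #|G|] amounts to [#|K| <= p ^ 2].

    If one of the three subgroups contains [Z], the TPP lets a central product
    be absorbed in that factor, so a triple in [K] is determined by its product
    and [#|K| <= p].  Otherwise [S], [T] and [U] meet [Z] trivially; they are
    then elementary abelian because [G / Z] is, and so is [K].  As commutators
    are central and bimultiplicative, the product map [K -> Z] fails to be a
    homomorphism only by a bimultiplicative term: under an identification of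
    [Z] with ['F_p] it is a polynomial function of degree at most 2.  The TPP
    says that the neutral triple is its only zero.  By Chevalley's theorem a
    polynomial function of degree [d] without constant term has a nontrivial
    zero as soon as there are more than [d] variables, so [K] has rank at most
    2.

    Chevalley's theorem is proved here without coordinates.  A function on
    an elementary abelian [p]-group [A] has degree less than [d] when all its
    [d]-fold finite differences vanish.  In characteristic [p], summing over
    the translates by the powers of one element is the same as taking [p - 1]
    differences, because [1 + X + ... + X ^ (p - 1) = (X - 1) ^ (p - 1)]; thus
    summing over [A] lowers the degree by [p - 1] times the rank of [A].  If
    [q] has degree at most [d], less than the rank, then [q ^ (p - 1)] has sum
    zero; but by Fermat's theorem this sum counts modulo [p] the points where
    [q] is nonzero, and if [1] were the only zero there would be [#|A| - 1] of
    them, which is [-1] modulo [p]. *)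

(** * Finite differences and degree of functions on a group *)

Section FiniteDifferences.

Set Implicit Arguments.
Unset Strict Implicit.
Unset Printing Implicit Defensive.

Import GRing.Theory.
Local Open Scope group_scope.
Local Open Scope ring_scope.

Variables (gT : finGroupType) (R : comNzRingType).
Implicit Types (A B : {group gT}) (g : gT -> R) (h x : gT) (d m : nat).

Definition diff h g : gT -> R := fun x => g (x * h)%g - g x.

(** Polynomial functions without coordinates: degree less than [d] on [A] means
    that all [d]-fold differences in directions of [A] vanish on [A].  The
    strict bound gives the zero function a place at [d = 0]. *)
Fixpoint degree_lt A d g : Prop :=
  if d is d'.+1 then {in A, forall h, degree_lt A d' (diff h g)}
  else {in A, forall x, g x = 0}.

Lemma eq_degree_lt A d g1 g2 :
  {in A, g1 =1 g2} -> degree_lt A d g1 -> degree_lt A d g2.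
Proof.
elim: d g1 g2 => [|d IHd] g1 g2 eq_g /= lt_g => [x Ax | h Ah].
  by rewrite -eq_g ?lt_g.
by apply: IHd (lt_g h Ah) => x Ax; rewrite /diff !eq_g ?groupM.
Qed.

Lemma degree_lt0 A d g : {in A, forall x, g x = 0} -> degree_lt A d g.
Proof.
elim: d g => [//|d IHd] g g0 h Ah; apply: IHd => x Ax.
by rewrite /diff !g0 ?groupM ?subrr.
Qed.

Lemma degree_ltW A d e g : (d <= e)%N -> degree_lt A d g -> degree_lt A e g.
Proof.
elim: d e g => [|d IHd] [|e] g // le_de lt_g; first exact: degree_lt0.
by move=> h Ah; apply: IHd (lt_g h Ah).
Qed.

Lemma degree_ltD A d g1 g2 :
  degree_lt A d g1 -> degree_lt A d g2 -> degree_lt A d (fun x => g1 x + g2 x).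
Proof.
elim: d g1 g2 => [|d IHd] g1 g2 /= lt1 lt2 => [x Ax | h Ah].
  by rewrite lt1 ?lt2 ?addr0.
apply: eq_degree_lt (IHd _ _ (lt1 h Ah) (lt2 h Ah)) => x _.
by rewrite /diff opprD addrACA.
Qed.

(** Differences and translations need not commute in a nonabelian group, but
    conjugating the direction of the difference makes up for it. *)
Lemma degree_lt_shift A d g h :
  h \in A -> degree_lt A d g -> degree_lt A d (fun x => g (x * h)%g).
Proof.
move=> Ah; elim: d g => [|d IHd] g /= lt_g => [x Ax | k Ak].
  by rewrite lt_g ?groupM.
apply: eq_degree_lt (IHd _ (lt_g (k ^ h)%g (groupJ Ak Ah))) => x _.
by rewrite /diff -!mulgA -conjgC.
Qed.

(** The predecessor is the bound for degrees at most [d1 - 1] and [d2 - 1]; it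
    also covers a zero factor.  The induction rests on the Leibniz rule for
    differences, in which one of the factors is translated. *)
Lemma degree_ltM A d1 d2 g1 g2 :
    degree_lt A d1 g1 -> degree_lt A d2 g2 ->
  degree_lt A (d1 + d2).-1 (fun x => g1 x * g2 x).
Proof.
have [n] := ubnP (d1 + d2)%N.
elim: n d1 d2 g1 g2 => // n IHn [|d1] [|d2] g1 g2 lt_n lt1 lt2;
  try by apply: degree_lt0 => x Ax; rewrite ?(lt1 x) ?(lt2 x) ?mul0r ?mulr0.
rewrite addSn addnS ltnS in lt_n *; move=> h Ah.
have ltD1 : degree_lt A (d1 + d2) (fun x => diff h g1 x * g2 (x * h)%g).
  have := IHn d1 d2.+1 _ _ _ (lt1 h Ah) (degree_lt_shift Ah lt2).
  by rewrite addnS; apply.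
have ltD2 : degree_lt A (d1 + d2) (fun x => g1 x * diff h g2 x).
  have := IHn d1.+1 d2 _ _ _ lt1 (lt2 h Ah).
  by rewrite addSn; apply.
apply: eq_degree_lt (degree_ltD ltD1 ltD2) => x _.
by rewrite /diff mulrBl mulrBr addrA subrK.
Qed.

Lemma degree_ltX A d g m :
  degree_lt A d.+1 g -> degree_lt A (d * m).+1 (fun x => g x ^+ m).
Proof.
move=> lt_g; elim: m => [|m IHm].
  by rewrite muln0 => h Ah x Ax; rewrite /diff subrr.
have := degree_ltM lt_g IHm; rewrite addSn addnS -pred_Sn -mulnS.
by apply: eq_degree_lt => x _; rewrite exprS.
Qed.

Lemma degree_lt_iter_diff A d g h m :
  h \in A -> degree_lt A (m + d) g -> degree_lt A d (iter m (diff h) g).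
Proof.
move=> Ah; elim: m d => [|m IHm] d //= lt_g.
by apply: (IHm d.+1); rewrite ?addnS.
Qed.

(** A difference in direction [h] is the action of ['X - 1] when ['X] acts by
    translation.  Leaving [N] free above the degree allows the induction to
    shift the indices of the sum. *)
Lemma iter_diff_poly h g m N x : (m < N)%N ->
  iter m (diff h) g x =
    \sum_(i < N) (('X - 1) ^+ m : {poly R})`_i * g (x * h ^+ i)%g.
Proof.
elim: m N x => [|m IHm] N x ltmN.
  case: N ltmN => // N _.
  rewrite expr0 big_ord_recl coef1 mul1r expg0 mulg1 big1 ?addr0 // => i _.
  by rewrite coef1 mul0r.
case: N ltmN => // N ltmN.
rewrite iterS -[LHS]/(iter m (diff h) g (x * h)%g - iter m (diff h) g x).
rewrite exprS mulrBl mul1r.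
under eq_bigr do rewrite coefB coefXM mulrBl.
rewrite sumrB -(IHm _ x (ltnW ltmN)) (IHm N) //; congr (_ - _).
rewrite big_ord_recl mul0r add0r.
by apply: eq_bigr => i _; rewrite lift0 /= expgS !mulgA.
Qed.

(** In characteristic [p], the Frobenius identity
    [('X - 1) ^ p = 'X ^ p - 1 = ('X - 1) (1 + ... + 'X ^ (p - 1))] can be
    cancelled by the monic factor ['X - 1]. *)
Lemma sum_translates_diff p h g x : p \in [pchar R] ->
  \sum_(i < p) g (x * h ^+ i)%g = iter p.-1 (diff h) g x.
Proof.
move=> charRp; have p_pr := pcharf_prime charRp.
rewrite (@iter_diff_poly _ _ _ p) ?prednK ?prime_gt0 //.
suff -> : ('X - 1) ^+ p.-1 = \sum_(i < p) 'X^i :> {poly R}.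
  apply: eq_bigr => i _; rewrite coef_sum (bigD1 i) //= coefXn eqxx.
  rewrite big1 ?addr0 ?mul1r // => j /negPf ne_ji.
  by rewrite coefXn eq_sym val_eqE ne_ji.
apply: (monic_lreg (monicXsubC 1)).
rewrite polyC1 -exprS prednK ?prime_gt0 // -subrX1.
have charPp : p \in [pchar {poly R}] by rewrite pchar_poly.
by rewrite -!(pFrobenius_autE charPp) rmorphB rmorph1.
Qed.

(** Splitting off a cyclic factor of order [p] from [B] turns part of the sum
    into [p - 1] differences, by [sum_translates_diff]. *)
Lemma degree_lt_sum_abelem p A B d g :
    p \in [pchar R] -> p.-abelem B -> B \subset A ->
    degree_lt A (logn p #|B| * p.-1 + d) g ->
  degree_lt A d (fun x => \sum_(b in B) g (x * b)%g).
Proof.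
move=> charRp; have p_pr := pcharf_prime charRp.
have [n] := ubnP #|B|; elim: n B d g => // n IHn B d g leBn abelB sBA lt_g.
have [B1 | /trivgPn [h Bh nt_h]] := eqVneq (B : {set gT}) 1%g.
  move: lt_g; rewrite B1 cards1 logn1 /=; apply: eq_degree_lt => x _.
  by rewrite big_set1 mulg1.
have oh : #[h]%g = p by apply: (abelem_order_p abelB).
have [C [sCB oC defB]] := p_abelem_split1 abelB Bh.
have [_ defM _ tiC] := dprodP defB.
have oB : #|B| = (p * #|C|)%N.
  by rewrite oC oh [RHS]mulnC divnK // -oh order_dvdG.
pose mulh (u : 'I_p * gT) : gT := (h ^+ u.1 * u.2)%g.
(* Reindex the sum over [B] along the splitting [B = <[h]> \x C]. *)
have inj_mulh : {in setX [set: 'I_p] C &, injective mulh}.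
  move=> [i b] [j c] /setXP[_ Cb] /setXP[_ Cc]; rewrite /mulh /= => eq_ij.
  have : ((h ^+ j)^-1 * h ^+ i)%g \in <[h]>%g :&: C.
    rewrite inE groupM ?groupV ?mem_cycle //=.
    by rewrite -(mulgK b (h ^+ i)%g) eq_ij !mulgA mulVg mul1g groupM ?groupV.
  rewrite tiC => /set1P/(congr1 (fun x => h ^+ j * x)%g).
  rewrite /= mulKVg mulg1 => eq_h; move: eq_ij; rewrite eq_h => /mulgI ->.
  by move/eqP: eq_h; rewrite eq_expg_ord ?oh // => /eqP->.
have im_mulh : mulh @: setX [set: 'I_p] C = B.
  apply/eqP; rewrite eqEcard card_in_imset // cardsX cardsT card_ord -oB leqnn.
  rewrite andbT; apply/subsetP => _ /imsetP[[i b] /setXP[_ Cb] ->].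
  by rewrite groupM ?groupX // (subsetP sCB).
have ltCn : (#|C| < n)%N.
  rewrite -ltnS; apply: leq_trans leBn.
  by rewrite ltnS oB ltn_Pmull ?prime_gt1 ?cardG_gt0.
have lt_h : degree_lt A (logn p #|C| * p.-1 + d) (iter p.-1 (diff h) g).
  apply: degree_lt_iter_diff; first exact: (subsetP sBA).
  have logB : logn p #|B| = (logn p #|C|).+1.
    by rewrite oB (lognM _ (prime_gt0 p_pr)) // logn_prime // eqxx.
  by move: lt_g; rewrite logB mulSn addnA.
have := IHn _ _ _ ltCn (abelemS sCB abelB) (subset_trans sCB sBA) lt_h.
apply: eq_degree_lt => x _.
under eq_bigr do rewrite -(sum_translates_diff _ _ _ charRp).
rewrite exchange_big /= -im_mulh big_imset //=.
rewrite (eq_bigl (fun u : 'I_p * gT => true && (u.2 \in C))); last first.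
  by move=> u; rewrite !inE.
rewrite -(pair_big xpredT (mem C)
           (fun (i : 'I_p) b => g (x * (h ^+ i * b))%g)) /=.
apply: eq_bigr => i _; apply: eq_bigr => b Cb.
have comm_hb : commute h b.
  by apply: (centsP (abelem_abelian abelB)) => //; apply: (subsetP sCB).
by rewrite -mulgA -(commuteX i (commute_sym comm_hb)).
Qed.

End FiniteDifferences.

(** * Chevalley's theorem on an elementary abelian group *)

Section Chevalley.

Set Implicit Arguments.
Unset Strict Implicit.
Unset Printing Implicit Defensive.

Import GRing.Theory.
Local Open Scope group_scope.
Local Open Scope ring_scope.

(** The first difference of [q] is affine and the second one is constant. *)
Lemma degree_lt_quadratic (gT : finGroupType) (R : comNzRingType)
    (A : {group gT}) (q : gT -> R) (b : gT -> gT -> R) :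
    {in A &, forall x y, q (x * y)%g = q x + q y + b x y} ->
    {in A & &, forall x y z, b (x * y)%g z = b x z + b y z} ->
  degree_lt A 3 q.
Proof.
move=> qM bM h Ah k Ak l Al x Ax.
have diff_q y : y \in A -> diff h q y = q h + b y h.
  by move=> Ay; rewrite /diff qM // -[_ + b y h]addrA addrAC subrr add0r.
have diff2_q y : y \in A -> diff k (diff h q) y = b k h.
  move=> Ay; rewrite {1}/diff !diff_q ?groupM // bM // opprD addrACA.
  by rewrite subrr add0r [b y h + _]addrC addrK.
by rewrite {1}/diff !diff2_q ?groupM // subrr.
Qed.

(** Chevalley's theorem, with the rank of [A] as the number of variables: were
    [1] the only zero, the sum of [q ^ (p - 1)] over [A] would be both [0], as
    the degree is too small, and [#|A| - 1 = -1]. *)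
Lemma exists_nontrivial_zero (p : nat) (gT : finGroupType) (A : {group gT})
    (d : nat) (q : gT -> 'F_p) :
    prime p -> p.-abelem A -> degree_lt A d.+1 q -> q 1%g = 0 ->
    (d < logn p #|A|)%N ->
  exists2 x, x \in A^#%g & q x = 0.
Proof.
move=> p_pr abelA lt_q q1 lt_d.
have [/exists_inP[x Ax /eqP qx0] | ] := boolP [exists x in A^#%g, q x == 0].
  by exists x.
rewrite negb_exists_in => /forall_inP nz_q.
have p1_gt0 : (0 < p.-1)%N by rewrite -subn1 subn_gt0 prime_gt1.
have lt_qX : degree_lt A (logn p #|A| * p.-1 + 0) (fun x => q x ^+ p.-1).
  by apply: degree_ltW (degree_ltX p.-1 lt_q); rewrite addn0 ltn_pmul2r.
have sum_qX := degree_lt_sum_abelem (pchar_Fp p_pr) abelA (subxx _) lt_qX.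
have := sum_qX 1%g (group1 A).
rewrite (bigD1 1%g) //= mulg1 q1 expr0n -[_ == 0%N]negbK -lt0n p1_gt0 add0r.
rewrite (eq_bigr (fun=> 1)) => [|x /andP[Ax ntx]]; last first.
  have nz_qx : q x != 0 by rewrite nz_q // !inE ntx.
  apply: (mulfI nz_qx); rewrite mulr1 mul1g -exprS prednK ?prime_gt0 //.
  by have := expf_card (q x); rewrite card_Fp.
move=> sum0; have: (#|A|)%:R = 0 :> 'F_p.
  apply/eqP; rewrite -(dvdn_pcharf (pchar_Fp p_pr)).
  rewrite [#|A|](card_pgroup (abelem_pgroup abelA)) dvdn_exp //.
  exact: leq_ltn_trans lt_d.
rewrite -sumr_const (bigD1 1%g) //= sum0 addr0 => /eqP.
by rewrite oner_eq0.
Qed.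

(** The discrete logarithm, which turns a group of order [p] into the field
    where [exists_nontrivial_zero] can be used. *)
Lemma prime_group_log (p : nat) (gT : finGroupType) (Z : {group gT}) :
    prime p -> #|Z| = p ->
  exists2 log : gT -> 'F_p,
    {in Z &, {morph log : x y / (x * y)%g >-> x + y}}
    & {in Z, forall x, log x = 0 -> x = 1%g}.
Proof.
move=> p_pr oZ; have /cyclicP[z defZ] : cyclic Z by rewrite prime_cyclic ?oZ.
have oz : #[z]%g = p by rewrite -oZ defZ.
pose log x : 'F_p :=
  if [pick i : 'I_p | x == z ^+ i]%g is Some i then i%:R else 0.
have logX m : log (z ^+ m)%g = m%:R.
  have lt_mp := ltn_pmod m (prime_gt0 p_pr).
  rewrite /log; case: pickP => [i | /(_ (Ordinal lt_mp))].
    rewrite eq_expg_mod_order oz => /eqP eq_mi.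
    by rewrite -(Fp_nat_mod p_pr m) eq_mi Fp_nat_mod.
  by rewrite /= -oz expg_mod_order eqxx.
exists log => [x y | x]; rewrite {}defZ.
  move=> /cycleP[i ->] /cycleP[j ->].
  by rewrite -expgD !logX natrD.
case/cycleP=> i ->; rewrite logX => /eqP.
by rewrite -(dvdn_pcharf (pchar_Fp p_pr)) -oz order_dvdn => /eqP.
Qed.

End Chevalley.

(** * Subgroup TPP triples of extraspecial groups *)

Section SubgroupTPPBound.

Set Implicit Arguments.
Unset Strict Implicit.
Unset Printing Implicit Defensive.

Local Open Scope group_scope.

Variable gT : finGroupType.
Implicit Types (G S T U : {group gT}) (x y z : gT).

Definition mul3 (k : gT * gT * gT) : gT := k.1.1 * k.1.2 * k.2.

(** The defect of multiplicativity of [mul3] when commutators are central; see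
    [mul3M]. *)
Definition mul3_comm (k l : gT * gT * gT) : gT :=
  [~ k.1.1, l.1.2] * [~ k.1.1 * k.1.2, l.2].

Lemma mem_setX3 S T U (k : gT * gT * gT) :
  (k \in setX (setX S T) U) = [&& k.1.1 \in S, k.1.2 \in T & k.2 \in U].
Proof. by rewrite !inE andbA. Qed.

Lemma subgroup_TPP_eq1 G S T U s t u :
    subgroup_TPP G S T U -> s \in S -> t \in T -> u \in U ->
  s * t * u = 1 -> [/\ s = 1, t = 1 & u = 1].
Proof.
case/and4P=> _ _ _ /forall_inP tpp Ss Tt Uu /eqP.
have /forall_inP/(_ t Tt)/forall_inP/(_ u Uu)/eqP-> := tpp s Ss.
by case/and3P=> /eqP-> /eqP-> /eqP->.
Qed.

Section Extraspecial.

Variables (p : nat) (G S T U : {group gT}).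
Hypotheses (p_pr : prime p) (pG : p.-group G) (esG : extraspecial G).
Hypothesis tpp : subgroup_TPP G S T U.

Let Z := 'Z(G)%G.
Let D := setX_group (setX_group S T) U.

Let sSG : S \subset G. Proof. by case/and4P: tpp. Qed.
Let sTG : T \subset G. Proof. by case/and4P: tpp. Qed.
Let sUG : U \subset G. Proof. by case/and4P: tpp. Qed.
Let oZ : #|Z| = p. Proof. exact: card_center_extraspecial pG esG. Qed.
Let der1G : G^`(1) = Z. Proof. by have [[_ ->]] := esG. Qed.
Let Z_central x z : z \in Z -> x \in G -> commute x z.
Proof. by case/centerP=> _ cGz Gx; apply/commute_sym/cGz. Qed.
Let mem_commZ x y : x \in G -> y \in G -> [~ x, y] \in Z.
Proof. by move=> Gx Gy; rewrite -der1G mem_commg. Qed.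
Let memD k : k \in D -> [/\ k.1.1 \in G, k.1.2 \in G & k.2 \in G].
Proof.
rewrite mem_setX3 => /and3P[Sk Tk Uk].
by split; [apply: (subsetP sSG) | apply: (subsetP sTG) | apply: (subsetP sUG)].
Qed.

Let mul3_G k : k \in D -> mul3 k \in G.
Proof. by case/memD=> Gs Gt Gu; rewrite !groupM. Qed.

Let commMr : {in G & &, forall x y z, [~ x, y * z] = [~ x, y] * [~ x, z]}.
Proof.
move=> x y z Gx Gy Gz; rewrite commgMJ conjgE.
rewrite -(Z_central (mem_commZ Gx Gy) Gz) mulKg.
exact: Z_central (mem_commZ Gx Gy) (groupR Gx Gz).
Qed.

Lemma mul3_commZ : {in D &, forall k l, mul3_comm k l \in Z}.
Proof.
move=> k l /memD[Gs Gt Gu] /memD[Gs' Gt' Gu'].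
by apply: groupM; apply: mem_commZ; rewrite ?groupM.
Qed.

(** Moving [l.1.1] past [k.1.2], and then [l.1.1 * l.1.2] past [k.2], costs
    two commutators, which are central. *)
Lemma mul3M : {in D &, forall k l,
  mul3 (k * l) = mul3 k * mul3 l * mul3_comm l k}.
Proof.
move=> [[s t] u] [[s' t'] u'] /memD[/= Gs Gt Gu] /memD[/= Gs' Gt' Gu'].
rewrite /mul3 /mul3_comm /=.
have Zst := mem_commZ Gs' Gt.
have Zstu := mem_commZ (groupM Gs' Gt') Gu.
have st_swap : s * s' * (t * t') * (u * u')
    = s * t * (s' * t' * u) * u' * [~ s', t].
  transitivity (s * (s' * t) * (t' * u * u')); first by rewrite !mulgA.
  rewrite (commgC s') (mulgA s) -(mulgA _ [~ s', t]).
  by rewrite -(Z_central Zst) ?groupM // !mulgA.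
rewrite st_swap (Z_central Zstu (groupR Gs' Gt)) (commgC (s' * t')).
rewrite (mulgA (s * t)) -(mulgA _ [~ s' * t', u]) -(Z_central Zstu Gu').
by rewrite -!mulgA.
Qed.

Lemma mul3_commMr : {in D & &, forall k l m,
  mul3_comm k (l * m) = mul3_comm k l * mul3_comm k m}.
Proof.
move=> k l m /memD[Gs Gt Gu] /memD[Gs' Gt' Gu'] /memD[Gs'' Gt'' Gu''].
have swap a b c d : b \in Z -> c \in G -> a * b * (c * d) = a * c * (b * d).
  by move=> Zb Gc; rewrite mulgA -(mulgA a) -(Z_central Zb Gc) !mulgA.
rewrite /mul3_comm /= !commMr ?groupM //.
by apply: swap; [apply: mem_commZ | apply: groupR => //; apply: groupM].
Qed.

Lemma coset_mul3M :
  {in D &, {morph (coset Z \o mul3) : k l / k * l >-> k * l}}.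
Proof.
move=> k l Dk Dl /=; have nZG := subsetP (normal_norm (center_normal G)).
have Zc := mul3_commZ Dl Dk; have Nc := nZG _ (subsetP (center_sub G) _ Zc).
have Nk := nZG _ (mul3_G Dk); have Nl := nZG _ (mul3_G Dl).
rewrite mul3M // (morphM _ (groupM Nk Nl) Nc) (morphM _ Nk Nl) /=.
by rewrite (coset_id Zc) mulg1.
Qed.

(* The triples with central product, as a kernel so that counting is an
   application of the first isomorphism theorem. *)
Let K := ('ker (Morphism coset_mul3M))%G.

Lemma mem_central_triples k : (k \in K) = (k \in D) && (mul3 k \in Z).
Proof.
rewrite inE; case: (boolP (k \in D)) => //= Dk.
have Nk := subsetP (normal_norm (center_normal G)) _ (mul3_G Dk).
have <- : (coset Z (mul3 k) == 1) = (mul3 k \in Z).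
  by apply/eqP/idP => [/(coset_idr Nk) | Zk]; last exact: coset_id.
by rewrite !inE.
Qed.

(** If for instance [Z] is contained in [S] and [s t u = z] is central, then
    [(s z^-1) t u = 1] is again a product of elements of [S], [T] and [U], and
    the TPP forces [s = z] and [t = u = 1]. *)
Lemma mul3_inj_central_triples :
    [|| Z \subset S, Z \subset T | Z \subset U] ->
  {in K &, injective mul3}.
Proof.
move=> sZ.
suff det z : z \in Z -> exists k0, {in K, forall k, mul3 k = z -> k = k0}.
  move=> k l Kk Kl eq_kl; have:= Kk; rewrite mem_central_triples => /andP[_ Zk].
  by have [k0 def_k0] := det _ Zk; rewrite (def_k0 k) // (def_k0 l).
move=> Zz; have cz := Z_central (groupVr Zz).
case/or3P: sZ => /subsetP/(_ _ (groupVr Zz)) Xz;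
  [exists (z, 1, 1) | exists (1, z, 1) | exists (1, 1, z)];
  move=> [[s t] u]; rewrite mem_central_triples mem_setX3 /mul3 /=;
  case/andP=> /and3P[Ss Tt Uu] _ def_z;
  have Gs := subsetP sSG s Ss; have Gt := subsetP sTG t Tt;
  have Gu := subsetP sUG u Uu.
- have [||||] := @subgroup_TPP_eq1 G S T U (s * z^-1) t u tpp;
    rewrite ?groupM //.
    by rewrite cz // -!mulgA (mulgA s) def_z mulVg.
  by move/(canRL (mulgKV _)); rewrite mul1g => -> -> ->.
- have [||||] := @subgroup_TPP_eq1 G S T U s (t * z^-1) u tpp;
    rewrite ?groupM //.
    by rewrite cz // (mulgA s) cz // -!mulgA (mulgA s) def_z mulVg.
  by move=> -> /(canRL (mulgKV _)); rewrite mul1g => -> ->.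
have [||||] := @subgroup_TPP_eq1 G S T U s t (u * z^-1) tpp;
  rewrite ?groupM //.
  by rewrite mulgA def_z mulgV.
by move=> -> -> /(canRL (mulgKV _)); rewrite mul1g => ->.
Qed.

(** Both the derived subgroup and the [p]-th powers of [X] lie in
    [G^`(1) = 'Phi(G) = Z], which [X] meets trivially. *)
Lemma TI_center_abelem (X : {group gT}) :
  X \subset G -> X :&: Z = 1 -> p.-abelem X.
Proof.
move=> sXG tiXZ; apply/abelemP => //; split=> [|x Xx].
  by apply/derG1P/trivgP; rewrite -tiXZ subsetI der_sub -der1G dergS.
apply/set1P; rewrite -[[set 1]]tiXZ inE groupX //=.
have Gx := subsetP sXG x Xx.
have [[defPhi _] _] := esG.
have abelGZ : p.-abelem (G / Z) by rewrite /Z /= -defPhi Phi_quotient_abelem.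
have Nx := subsetP (normal_norm (center_normal G)) x Gx.
apply: coset_idr; first by rewrite groupX.
by rewrite morphX //; have [_ ->] := abelemP p_pr abelGZ; rewrite ?mem_quotient.
Qed.

Lemma central_triples_abelem :
  S :&: Z = 1 -> T :&: Z = 1 -> U :&: Z = 1 -> p.-abelem K.
Proof.
move=> tiS tiT tiU.
have /(abelemP p_pr)[cSS expS] := TI_center_abelem sSG tiS.
have /(abelemP p_pr)[cTT expT] := TI_center_abelem sTG tiT.
have /(abelemP p_pr)[cUU expU] := TI_center_abelem sUG tiU.
have sKD : K \subset D by exact: subsetIl.
apply: abelemS sKD _.
apply/abelemP => //; split.
  apply/centsP=> -[[s t] u]; rewrite mem_setX3 => /and3P[/= Ss Tt Uu].
  move=> [[s' t'] u']; rewrite mem_setX3 => /and3P[/= Ss' Tt' Uu'].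
  congr (_, _, _);
    [exact: (centsP cSS) | exact: (centsP cTT) | exact: (centsP cUU)].
move=> [[s t] u]; rewrite mem_setX3 => /and3P[/= Ss Tt Uu].
have expX m : (s, t, u) ^+ m = (s ^+ m, t ^+ m, u ^+ m).
  by elim: m => // m IHm; rewrite !expgS IHm.
by rewrite expX expS // expT // expU.
Qed.

(** Either the product is injective from [K] to [Z], or [K] is elementary
    abelian and the logarithm of the product is a polynomial function on [K]
    of degree at most 2, whose only zero is trivial. *)
Lemma card_central_triples : #|K| <= p ^ 2.
Proof.
have sKZ k : k \in K -> mul3 k \in Z by rewrite mem_central_triples => /andP[].
have sKD k : k \in K -> k \in D by rewrite mem_central_triples => /andP[].
have [sZ | ] := boolP [|| Z \subset S, Z \subset T | Z \subset U].
  rewrite -(card_in_imset (mul3_inj_central_triples sZ)).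
  apply: (@leq_trans p); last by rewrite leq_pmull ?prime_gt0.
  rewrite -[leqRHS]oZ subset_leq_card //.
  by apply/subsetP=> _ /imsetP[k /sKZ Zk ->].
have prZ : prime #|Z| by rewrite oZ.
have tiZ (X : {group gT}) : ~~ (Z \subset X) -> X :&: Z = 1.
  by rewrite setIC; apply: prime_TIg.
rewrite !negb_or => /and3P[/tiZ tiS /tiZ tiT /tiZ tiU].
have abelK := central_triples_abelem tiS tiT tiU.
rewrite (card_pgroup (abelem_pgroup abelK)) leq_exp2l ?prime_gt1 // leqNgt.
apply/negP=> lt_K.
have [log logM log_eq0] := prime_group_log p_pr oZ.
have ZcommK : {in K &, forall k l, mul3_comm k l \in Z}.
  by move=> k l /sKD Dk /sKD Dl; apply: mul3_commZ.
have deg_log : degree_lt K 3 (log \o mul3).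
  apply: (@degree_lt_quadratic _ _ _ _ (fun k l => log (mul3_comm l k))).
    move=> k l Kk Kl; rewrite /= mul3M ?sKD //.
    have Zkl : mul3 k * mul3 l \in Z by apply: groupM; apply: sKZ.
    rewrite (logM _ _ Zkl (ZcommK _ _ Kl Kk)).
    by rewrite (logM _ _ (sKZ _ Kk) (sKZ _ Kl)).
  move=> k l m /sKD Dk /sKD Dl /sKD Dm; rewrite mul3_commMr //.
  by apply: logM; apply: mul3_commZ.
have log1 : (log \o mul3) 1 = 0%R.
  rewrite /= /mul3 !mulg1; have := logM 1 1 (group1 Z) (group1 Z).
  by rewrite mulg1 => /eqP; rewrite -GRing.subr_eq GRing.subrr => /eqP.
have [k] := exists_nontrivial_zero p_pr abelK deg_log log1 lt_K.
case/setD1P=> nt_k Kk /(log_eq0 _ (sKZ _ Kk)) k1; case/eqP: nt_k.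
move: k Kk k1 => [[s t] u] /sKD; rewrite mem_setX3 => /and3P[/= Ss Tt Uu].
by case/(subgroup_TPP_eq1 tpp Ss Tt Uu) => -> -> ->.
Qed.

Lemma extraspecial_TPP_card : #|S| * #|T| * #|U| <= p * #|G|.
Proof.
rewrite -!cardsX -[#|_|]/#|D| -(Lagrange (subsetIl D _ : K \subset D)).
have oGZ : #|G| = (p * #|G / Z|)%N.
  rewrite -oZ card_quotient ?normal_norm ?center_normal //.
  by rewrite Lagrange ?center_sub.
have -> : #|D : K| = #|Morphism coset_mul3M @* D|.
  by rewrite card_morphim setIid.
rewrite oGZ mulnA leq_mul ?card_central_triples //.
rewrite subset_leq_card //; apply/subsetP=> _ /morphimP[k _ Dk ->].
by rewrite mem_quotient ?mul3_G.
Qed.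

End Extraspecial.

End SubgroupTPPBound.

Theorem corollary4p2 (p n : nat) (gT : finGroupType) (G : {group gT})
  (p_prime : prime p) (n_ge1 : (1 <= n)%N)
  (G_extraspecial : extraspecial G)
  (G_order : #|G| = (p ^ (1 + 2 * n))%N) :
  (rho0 G <= p%:R)%R.
Proof.
have pG : (p.-group G)%g by rewrite /pgroup G_order pnatX pnat_id.
apply: Order.POrderTheory.bigmax_le => [|[[S T] U] tpp].
  exact: Num.Theory.ler0n.
rewrite Num.Theory.ler_pdivrMr ?Num.Theory.ltr0n ?cardG_gt0 //.
rewrite -GRing.natrM Num.Theory.ler_nat.
exact: extraspecial_TPP_card tpp.
Qed.
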